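(* Let $R=k[x_1,\dots,x_n]$ be positively graded by $\deg(x_i)=a_i\in A$, let $I\subset R$ be a homogeneous ideal and $\Omega\subset S_A$ a truncating subset. Let $C_\Omega[\omega_1]$ and $C_\Omega[\omega_2]$ be maximal cells in the truncated Gröbner fan $\mathcal{F}_\Omega(I)$ of $I$. Suppose that $G$ is the reduced $\Omega$-Gröbner basis for $I$ over $\omega_1$. If $\omega\in\overline{C_\Omega[\omega_1]}\cap\overline{C_\Omega[\omega_2]}$, then: (i) The reduced $\Omega$-Gröbner basis for $\operatorname{in}_\omega(I)$ over $\omega_1$ is $G_\omega=\{\operatorname{in}_\omega(g)\mid g\in G\}$. (ii) If $H$ is the reduced $\Omega$-Gröbner basis for $\operatorname{in}_\omega(I)$ over $\omega_2$, then $\{f-f^G\mid f\in H\}$ is a minimal $\Omega$-Gröbner basis for $I$ over $\omega_2$ modified by $\omega$. (iii) The reduced $\Omega$-Gröbner basis for $I$ over $\omega_2$ modified by $\omega$ coincides with the reduced $\Omega$-Gröbner basis for $I$ over $\omega_2$.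
   Context: $k$ is a field, $R=k[x_1,\dots,x_n]$, and $a_1,\dots,a_n$ are elements of an abelian group $(A,+)$. $\mathbb{N}$ contains $0$. Put $S_A=\mathbb{N}a_1+\cdots+\mathbb{N}a_n\subset A$ and $\deg(x^v)=v_1a_1+\cdots+v_na_n$ for $v\in\mathbb{N}^n$. For $s\in A$ let $R_s$ be the $k$-span of the monomials of degree $s$; this gives an $A$-grading of $R$. $R$ is positively graded if $R_0=k$ (equivalently $\dim_k R_s<\infty$ for all $s\in S_A$). For an ideal $J$, $J_s=J\cap R_s$, and $J$ is homogeneous if $J=\bigoplus_s J_s$. A subset $\Omega\subset S_A$ is truncating if for all $s,t\in S_A$, $s+t\in\Omega$ implies $s,t\in\Omega$. For a homogeneous ideal $J$ put $J_\Omega=\bigoplus_{s\in\Omega}J_s$. A total multiplicative ordering $\prec$ is a total order on the monomials of $R$ with $x^u\prec x^v\Rightarrow x^{u+w}\prec x^{v+w}$; the monomial $1$ is not required to be minimal. $\operatorname{in}_\prec(f)$ is the $\prec$-maximal term of $f\neq0$; for a subset $G\subset R$, $\operatorname{in}_\prec(G)$ is the ideal generated by the $\operatorname{in}_\prec(f)$, $f\in G\setminus\{0\}$. For $\eta\in\mathbb{R}^n$, $\operatorname{in}_\eta(f)$ is the sum of the terms $c_vx^v$ of $f$ with $\eta\cdot v$ maximal, and $\operatorname{in}_\eta(J)$ is the ideal generated by the $\operatorname{in}_\eta(f)$, $f\in J\setminus\{0\}$. The ordering $\prec_\eta$ is defined by $x^u\prec_\eta x^v$ iff $\eta\cdot u<\eta\cdot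 v$, or $\eta\cdot u=\eta\cdot v$ and $x^u\prec x^v$. Put $C_\Omega[\omega]=\{v\in\mathbb{R}^n\mid\operatorname{in}_v(I)_\Omega=\operatorname{in}_\omega(I)_\Omega\}$; the truncated Gröbner fan is $\mathcal{F}_\Omega(I)=\{\overline{C_\Omega[\omega]}\mid\omega\in\mathbb{R}^n\}$, a complete fan. $C_\Omega[\omega]$ is called a maximal cell if its closure is a maximal ($n$-dimensional) cone of this fan. For a homogeneous ideal $J$ and a total multiplicative ordering $\prec$, an $\Omega$-Gröbner basis for $J$ over $\prec$ is a finite set $G\subset J$ of nonzero homogeneous elements with degrees in $\Omega$ such that $\operatorname{in}_\prec(J)_\Omega=\operatorname{in}_\prec(G)_\Omega$. It is minimal if no element can be left out. It is reduced if all initial terms $\operatorname{in}_\prec(g)$, $g\in G$, have coefficient $1$, $\operatorname{in}_\prec(g)$ divides no term of $g'$ for $g\ne g'$ in $G$, and $\operatorname{in}_\prec(g)$ divides no non-initial term of $g$. The reduced $\Omega$-Gröbner basis is unique. Orderings represented by weight vectors: fix for $i=1,2$ any total multiplicative ordering $\prec_i$ represented by $\omega_i$, i.e. such that $\omega_i\cdot u<\omega_i\cdot v$ implies $x^u\prec_i x^v$. ''Over $\omega_i$'' means over $\prec_i$, and ''over $\omega_2$ modified by $\omega$'' means over $(\prec_2)_\omega$. Finally, $f^G$ denotes the remainder (normal form) of $f$ upon division by $G$ with respect to $\prec_1$: the unique polynomial with $f-f^G\in I$, homogeneous of the same degree as $f$ (or zero), none of whose monomials is divisible by any $\operatorname{in}_{\prec_1}(g)$,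 $g\in G$ (here $f$ is homogeneous of degree in $\Omega$). *)

(* Defs.v *)
From mathcomp Require Import all_boot all_order all_algebra.
From mathcomp Require Import boolp classical_sets functions cardinality reals.
From mathcomp Require Import topology normedtype.
(* The notations of mpoly.v cannot be parsed together with those of
   mathcomp-analysis. *)
From mathcomp Require Import -(notations) mpoly.

Set Implicit Arguments.
Unset Strict Implicit.
Unset Printing Implicit Defensive.

Import Order.TTheory GRing.Theory Num.Theory.
Import numFieldNormedType.Exports.

Local Open Scope classical_set_scope.
Local Open Scope ring_scope.

Notation "{ 'mpoly' k [ n ] }" := (mpoly n k)
  (at level 0, k at level 2, format "{ 'mpoly'  k [ n ] }").

Section Grading.
Variables (k : fieldType) (n : nat) (A : zmodType) (a : 'I_n -> A).
Implicit Types (f : {mpoly k[n]}) (J : set {mpoly k[n]}) (Omega : set A).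

Definition wdeg (m : multinom n) : A := \sum_(i < n) a i *+ m i.

Definition SA : set A := range wdeg.

(* f belongs to R_s; in particular 0 is homogeneous of every degree. *)
Definition homog (s : A) f : Prop := forall m, m \in msupp f -> wdeg m = s.

Definition positively_graded : Prop := homog 0 = range (@mpolyC n k).

Definition hcomp (s : A) f : {mpoly k[n]} :=
  \sum_(m <- msupp f | wdeg m == s) mcoeff m f *: mpolyX k m.

Definition homogeneous J : Prop := forall f s, J f -> J (hcomp s f).

Definition truncating Omega : Prop :=
  Omega `<=` SA /\
  forall s t, SA s -> SA t -> Omega (s + t) -> Omega s /\ Omega t.

(* J_Omega, the direct sum of the J `&` R_s for s in Omega, as a subset of R *)
Definition trunc Omega J : set {mpoly k[n]} :=
  [set f | (forall s, J (hcomp s f)) /\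
           (forall m, m \in msupp f -> Omega (wdeg m))].

End Grading.

Section InitialIdeals.
Variables (k : fieldType) (n : nat).
Implicit Types (f g : {mpoly k[n]}) (J G : set {mpoly k[n]}).
Implicit Types (lt : rel (multinom n)).

Definition is_ideal J : Prop :=
  [/\ J 0, (forall f g, J f -> J g -> J (f + g))
         & (forall f g, J g -> J (f * g))].

Definition ideal_gen G : set {mpoly k[n]} := smallest is_ideal G.

(* lt is the strict order; 1 (the multinomial mnm0) need not be minimal. *)
Definition total_mult_order lt : Prop :=
  [/\ irreflexive lt, transitive lt,
      (forall u v, u != v -> lt u v || lt v u)
    & (forall u v w, lt u v -> lt (mnm_add u w) (mnm_add v w))].

(* exponent of the lt-maximal monomial of f; only meaningful for f != 0 *)
Definition init_mon lt f : multinom n :=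
  xget (@mnm0 n)
    [set m | m \in msupp f /\
             forall m', m' \in msupp f -> m' != m -> lt m' m].

Definition init_coef lt f : k := mcoeff (init_mon lt f) f.

Definition init_term lt f : {mpoly k[n]} :=
  init_coef lt f *: mpolyX k (init_mon lt f).

Definition init_ideal lt G : set {mpoly k[n]} :=
  ideal_gen [set init_term lt f | f in G `\ 0].

Section Weights.
Variable R : realType.
Implicit Types (eta : 'rV[R]_n).

Definition wdot eta (m : multinom n) : R := \sum_(i < n) eta ord0 i * (m i)%:R.

Definition init_form eta f : {mpoly k[n]} :=
  \sum_(m <- msupp f | all (fun m' => wdot eta m' <= wdot eta m) (msupp f))
     mcoeff m f *: mpolyX k m.

Definition init_form_ideal eta J : set {mpoly k[n]} :=
  ideal_gen [set init_form eta f | f in J `\ 0].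

(* the ordering lt_eta, i.e. lt modified by eta *)
Definition modified lt eta : rel (multinom n) :=
  fun u v => (wdot eta u < wdot eta v) ||
             ((wdot eta u == wdot eta v) && lt u v).

Definition represented_by lt eta : Prop :=
  forall u v, wdot eta u < wdot eta v -> lt u v.

End Weights.
End InitialIdeals.

Section TruncatedFan.
Variables (k : fieldType) (n : nat) (A : zmodType) (a : 'I_n -> A).
Variables (R : realType) (Omega : set A) (I : set {mpoly k[n]}).

Definition cell (w : 'rV[R]_n) : set 'rV[R]_n :=
  [set v | trunc a Omega (init_form_ideal v I)
         = trunc a Omega (init_form_ideal w I)].

Definition groebner_fan : set (set 'rV[R]_n) :=
  [set closure (cell w) | w in setT].

Definition maximal_cell (w : 'rV[R]_n) : Prop :=
  forall D, groebner_fan D -> closure (cell w) `<=` D -> D = closure (cell w).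

End TruncatedFan.

Section GroebnerBases.
Variables (k : fieldType) (n : nat) (A : zmodType) (a : 'I_n -> A).
Variables (Omega : set A) (lt : rel (multinom n)).
Implicit Types (J G : set {mpoly k[n]}).

Definition groebner_basis J G : Prop :=
  [/\ finite_set G, G `<=` J,
      (forall g, G g -> g != 0 /\ exists2 s, Omega s & homog a s g)
    & trunc a Omega (init_ideal lt J) = trunc a Omega (init_ideal lt G)].

Definition minimal_groebner_basis J G : Prop :=
  groebner_basis J G /\ forall g, G g -> ~ groebner_basis J (G `\ g).

(* lem is divisibility of monomials. *)
Definition reduced_groebner_basis J G : Prop :=
  [/\ groebner_basis J G,
      (forall g, G g -> init_coef lt g = 1),
      (forall g g' m, G g -> G g' -> g <> g' -> m \in msupp g' ->
         ~~ lem (init_mon lt g) m)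
    & (forall g m, G g -> m \in msupp g -> m != init_mon lt g ->
         ~~ lem (init_mon lt g) m)].

Definition is_normal_form J G (f r : {mpoly k[n]}) : Prop :=
  [/\ J (f - r), (forall s, homog a s f -> homog a s r)
    & (forall g m, G g -> m \in msupp r -> ~~ lem (init_mon lt g) m)].

(* f^G, for f homogeneous of degree in Omega and G a groebner_basis of J *)
Definition normal_form J G (f : {mpoly k[n]}) : {mpoly k[n]} :=
  xget 0 (is_normal_form J G f).

End GroebnerBases.

(* Main.v *)
Require Import Defs.
From mathcomp Require Import all_boot all_order all_algebra.
From mathcomp Require Import boolp classical_sets functions cardinality reals.
From mathcomp Require Import topology normedtype.
From mathcomp Require Import -(notations) mpoly.
Set Implicit Arguments.
Unset Strict Implicit.
Unset Printing Implicit Defensive.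
Import Order.TTheory GRing.Theory Num.Theory.
Import numFieldNormedType.Exports.
Local Open Scope classical_set_scope.
Local Open Scope ring_scope.

(** Write lt_w for [modified lt w]. For every total multiplicative ordering lt
    the ideals in_lt(in_w(I)) and in_{lt_w}(I) contain the same monomials
    ([initial_mon_init_form_ideal]): an element of in_w(I) agrees in each weight
    c with an element of I all of whose terms have weight at most c.

    Let lt be represented by w1, let G be the reduced basis of I over lt, and let
    v be in the cell of w1. Then lt = lt_w1, and since in_v(I) and in_w1(I) have
    the same truncation, so have in_{lt_v}(I) and in_lt(I). In an element g of G
    only one monomial lies in in_lt(I), namely the initial one, so it is also the
    initial monomial for lt_v; hence no term of g has larger v-weight. This last
    condition is closed in v, so it persists for w in the closure of the cell,
    and there in_{lt_w}(g) = in_lt(g) for all g in G ([closure_cell_init_mon]).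
    Thus in_lt(I) is contained in in_{lt_w}(I) in all degrees of Omega.
    Containment forces equality, because for each ordering the standard monomials
    of a degree form a basis of the quotient in that degree
    ([initial_mon_le_eq]); this uses that there are finitely many monomials of
    each degree, a consequence of the positive grading and of Dickson's lemma.
    So G is also the reduced basis over lt_w ([reduced_modified]). For w2 this is
    (iii), and for w1, together with the first paragraph, it gives (i).

    For (ii), a reduced basis H of the w-homogeneous ideal in_w(I) consists of
    w-homogeneous polynomials. Let f be in H, of weight c. Reducing f modulo G
    never raises the weight, so the normal form r of f has weights at most c.
    Weight c does not occur in r: f agrees in weight c with some f' in I without
    heavier terms, and if r had a term of weight c, the initial monomial over
    lt1_w of the element f' - (f - r) of I would be a term of r, although r
    has only standard monomials ([normal_form_lift]).
    So f - r has over lt2_w the initial monomial that f has over lt2, and the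
    initial monomials of H generate in_lt2(in_w(I)) = in_{lt2_w}(I) irredundantly
    in the degrees of Omega ([lift_minimal_groebner_basis]). *)

(** * Divisibility of monomials *)

Section Monomials.
Variable n : nat.
Implicit Types (u v m : multinom n) (P : set (multinom n)).

(** By induction on the number j of coordinates that are compared. If B0 works
    for the first j coordinates and N bounds the next coordinate on B0, then B0
    handles the m whose next coordinate is at least N, and the others fall into
    N slices on which that coordinate is constant. *)
Lemma dickson P : exists B : seq (multinom n),
  (forall b, b \in B -> P b) /\ (forall m, P m -> exists2 b, b \in B & lem b m).
Proof.
suff low (j : nat) : (j <= n)%N -> forall P, exists B : seq (multinom n),
    (forall b, b \in B -> P b) /\
    (forall m, P m ->
       exists2 b, b \in B & forall i : 'I_n, (i < j)%N -> (b i <= m i)%N).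
  have [B [BP Bm]] := low n (leqnn n) P; exists B; split=> // m Pm.
  have [b bB bm] := Bm m Pm; exists b => //.
  by apply/mnm_lepP => i; exact: bm.
elim: j => [|j IH] lejn Q.
  have [[m0 Qm0]|Q0] := pselect (exists m, Q m).
    exists [:: m0]; split=> [b|m _]; first by rewrite inE => /eqP->.
    by exists m0; rewrite ?mem_head.
  by exists [::]; split=> // m Qm; case: Q0; exists m.
have [B0 [B0Q B0m]] := IH (ltnW lejn) Q.
pose oj := Ordinal lejn.
pose N := (\max_(b <- B0) b oj)%N.
have [F HF] := choice (fun d => IH (ltnW lejn) [set m | Q m /\ m oj = d]).
exists (B0 ++ flatten [seq F d | d <- iota 0 N]); split=> [b|m Qm].
  rewrite mem_cat => /orP[/B0Q//|/flatten_mapP[d _ bF]].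
  by case: ((HF d).1 b bF).
have [leN|ltN] := leqP N (m oj).
  have [b bB bm] := B0m m Qm; exists b; first by rewrite mem_cat bB.
  move=> i; rewrite ltnS leq_eqVlt => /orP[/eqP ij|]; last exact: bm.
  have -> : i = oj by apply/val_inj.
  by apply: leq_trans leN; exact: leq_bigmax_seq.
have [b bF bm] := (HF (m oj)).2 m (conj Qm erefl).
exists b.
  rewrite mem_cat; apply/orP; right; apply/flatten_mapP.
  by exists (m oj); rewrite // mem_iota.
move=> i; rewrite ltnS leq_eqVlt => /orP[/eqP ij|]; last exact: bm.
have -> : i = oj by apply/val_inj.
by have [_ ->] := (HF (m oj)).1 b bF.
Qed.

Lemma lemP u v : reflect (exists t, v = mnm_add t u) (lem u v).
Proof.
apply: (iffP idP) => [uv|[t ->]]; first by exists (mnm_sub v u); rewrite submK.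
exact: lem_addl.
Qed.

Lemma lem_anti u v : lem u v -> lem v u -> u = v.
Proof.
move=> /mnm_lepP uv /mnm_lepP vu; apply/mnmP => i.
by apply/eqP; rewrite eqn_leq uv vu.
Qed.

Lemma minimal_divisor P m : P m ->
  exists b, [/\ P b, lem b m & forall u, P u -> lem u b -> u = b].
Proof.
have [d] := ubnP (mdeg m); elim: d m => // d IH m ltd Pm.
have [[u [Pu um unm]]|no] :=
  pselect (exists u, [/\ P u, lem u m & u <> m]); last first.
  exists m; split; rewrite ?lepm_refl // => u Pu um.
  by apply: contrapT => unm; apply: no; exists u.
have ltum : (mdeg u < mdeg m)%N.
  have /lemP[t mE] := um; rewrite mE mdegD -[ltnLHS]add0n ltn_add2r lt0n.
  apply/eqP => /eqP; rewrite mdeg_eq0 => /eqP t0; apply: unm.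
  by rewrite mE t0 add0m.
have [|b [Pb bu bmin]] := IH u _ Pu; first exact: leq_trans ltum _.
by exists b; split=> //; exact: lepm_trans bu um.
Qed.

End Monomials.

(** * Monomials of a given degree *)

Section Degrees.
Variables (k : fieldType) (n : nat) (A : zmodType) (a : 'I_n -> A).
Implicit Types (u v m : multinom n).

Lemma wdegD u v : wdeg a (mnm_add u v) = wdeg a u + wdeg a v.
Proof.
by rewrite /wdeg -big_split /=; apply: eq_bigr => i _; rewrite mnmDE mulrnDr.
Qed.

(** A quotient of two monomials of equal degree has degree 0, hence is 1; so the
    monomials of one degree form an antichain, and antichains are finite. *)
Lemma positively_graded_finite : positively_graded k a ->
  forall s, exists S : seq (multinom n), forall m, wdeg a m = s -> m \in S.
Proof.
move=> pg s; have [B [BP Bm]] := dickson [set m | wdeg a m = s].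
exists B => m ms; have [b bB /lemP[t mE]] := Bm m ms.
suff t0 : t = mnm0 by rewrite mE t0 add0m.
have dt : wdeg a t = 0.
  by apply: (addIr (wdeg a b)); rewrite -wdegD -mE ms add0r (BP b bB).
have : homog a 0 (mpolyX k t) by move=> m'; rewrite msuppX inE => /eqP->.
rewrite pg => -[c _ cE]; apply: contrapT => /eqP t0.
have : mcoeff t (mpolyX k t) = 1 by rewrite mcoeffX eqxx.
by rewrite -cE mcoeffC (negPf t0) mulr0 => /esym/eqP; rewrite oner_eq0.
Qed.

End Degrees.

(** * Initial monomials *)

Section Orders.
Variables (n : nat) (lt : rel (multinom n)).
Hypothesis ltO : total_mult_order lt.
Implicit Types (u v m : multinom n).

Lemma tmo_irr u : lt u u = false. Proof. by have [->] := ltO. Qed.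

Lemma tmo_trans v u m : lt u v -> lt v m -> lt u m.
Proof. by have [_ tr _ _] := ltO; exact: tr. Qed.

Lemma tmo_total u v : u != v -> lt u v || lt v u.
Proof. by have [_ _ + _] := ltO; exact. Qed.

Lemma tmo_add m u v : lt u v -> lt (mnm_add m u) (mnm_add m v).
Proof. by have [_ _ _ add] := ltO; rewrite !(addmC m); exact: add. Qed.

Lemma tmo_asym u v : lt u v -> lt v u -> False.
Proof. by move=> uv /(tmo_trans uv); rewrite tmo_irr. Qed.

Lemma tmo_max (s : seq (multinom n)) : s != [::] ->
  exists2 m, m \in s & forall m', m' \in s -> m' != m -> lt m' m.
Proof.
elim: s => // x s IH _; have [->|s0] := eqVneq s [::].
  by exists x => [|m']; rewrite inE // => /eqP->; rewrite eqxx.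
have [m ms mmax] := IH s0; have [xm|xm] := eqVneq x m.
  exists m => [|m']; rewrite inE ?ms ?orbT // => /orP[/eqP->|]; last exact: mmax.
  by rewrite xm eqxx.
have /orP[ltxm|ltmx] := tmo_total xm.
  by exists m => [|m']; rewrite inE ?ms ?orbT // => /orP[/eqP->|]; last exact: mmax.
exists x => [|m']; rewrite inE ?eqxx // => /orP[/eqP->|m's]; first by rewrite eqxx.
move=> _; have [->//|m'm] := eqVneq m' m.
exact: tmo_trans (mmax _ m's m'm) ltmx.
Qed.

Variable k : fieldType.
Implicit Types (f g : {mpoly k[n]}).

Lemma init_mon_unique f m : m \in msupp f ->
  (forall m', m' \in msupp f -> m' != m -> lt m' m) -> init_mon lt f = m.
Proof.
move=> mf mmax; rewrite /init_mon; case: xgetP => [m1 _ [m1f m1max]|/(_ m)[]//].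
have [//|mm1] := eqVneq m1 m.
have := m1max m mf; rewrite eq_sym mm1 => /(_ isT) lt1.
by case: (tmo_asym lt1 (mmax _ m1f mm1)).
Qed.

Lemma init_monP f : f != 0 -> init_mon lt f \in msupp f /\
  forall m, m \in msupp f -> m != init_mon lt f -> lt m (init_mon lt f).
Proof.
rewrite -msupp_eq0 => /tmo_max[m mf mmax].
by rewrite (init_mon_unique mf mmax).
Qed.

Lemma init_mon_supp f : f != 0 -> init_mon lt f \in msupp f.
Proof. by move=> /init_monP[]. Qed.

Lemma init_monMX u f : f != 0 -> init_mon lt (mpolyX k u * f) = mnm_add u (init_mon lt f).
Proof.
move=> f0; have [inf maxf] := init_monP f0.
have supp m : (m \in msupp (mpolyX k u * f)) =
    (m \in [seq mnm_add u m' | m' <- msupp f]).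
  by rewrite mulrC; exact: (perm_mem (msuppMX f u)).
apply: init_mon_unique => [|m]; rewrite supp.
  by apply/mapP; exists (init_mon lt f).
move=> /mapP[m' m'f ->]; rewrite eqm_add2l => m'i.
by apply: tmo_add; exact: maxf.
Qed.

End Orders.

(** * Ideals and their initial monomials *)

Section Restriction.
Variables (k : fieldType) (n : nat).
Implicit Types (f g : {mpoly k[n]}) (m : multinom n) (Q : pred (multinom n)).

(** [hcomp], [init_form] and [wcomp] below are all sums of this shape. *)
Lemma mcoeff_restrict Q f m :
  mcoeff m (\sum_(u <- msupp f | Q u) mcoeff u f *: mpolyX k u) =
  if Q m then mcoeff m f else 0.
Proof.
rewrite raddf_sum /= big_mkcond /=.
have [mf|mf] := boolP (m \in msupp f).
  rewrite (bigD1_seq m) //= big1 => [|u um].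
    by rewrite addr0 mcoeffZ mcoeffX eqxx mulr1.
  by case: (Q u); rewrite // mcoeffZ mcoeffX (negPf um) mulr0.
have /eqP f0 : mcoeff m f == 0 by rewrite mcoeff_eq0.
rewrite f0 if_same big1_seq // => u /andP[_ uf].
case: (Q u); rewrite // mcoeffZ mcoeffX; case: eqP => [um|]; last by rewrite mulr0.
by rewrite -um uf in mf.
Qed.

Lemma msupp_restrict Q f m :
  (m \in msupp (\sum_(u <- msupp f | Q u) mcoeff u f *: mpolyX k u)) =
  Q m && (m \in msupp f).
Proof. by rewrite !mcoeff_msupp mcoeff_restrict; case: (Q m); rewrite //= eqxx. Qed.

End Restriction.

Section Ideals.
Variables (k : fieldType) (n : nat).
Implicit Types (f g : {mpoly k[n]}) (m u : multinom n) (J G : set {mpoly k[n]}).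

Lemma ideal_genP G : is_ideal (ideal_gen G).
Proof.
split=> [J [[J0 _ _] _]//|f g Gf Gg J HJ|f g Gg J HJ].
  by have [[_ JD _] _] := HJ; exact: JD (Gf J HJ) (Gg J HJ).
by have [[_ _ JM] _] := HJ; exact: JM (Gg J HJ).
Qed.

Lemma ideal_genS G : G `<=` ideal_gen G.
Proof. by move=> g Gg J [_]; exact. Qed.

Lemma ideal_gen_sub G J : is_ideal J -> G `<=` J -> ideal_gen G `<=` J.
Proof. by move=> iJ GJ f; apply. Qed.

Variable J : set {mpoly k[n]}.
Hypothesis iJ : is_ideal J.

Lemma ideal0 : J 0. Proof. by have [] := iJ. Qed.

Lemma idealD f g : J f -> J g -> J (f + g).
Proof. by have [_ + _] := iJ; exact. Qed.

Lemma idealM f g : J g -> J (f * g).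
Proof. by have [_ _] := iJ; exact. Qed.

Lemma idealZ c f : J f -> J (c *: f).
Proof. by rewrite -mul_mpolyC; exact: idealM. Qed.

Lemma idealB f g : J f -> J g -> J (f - g).
Proof. by move=> Jf Jg; apply: idealD => //; rewrite -scaleN1r; exact: idealZ. Qed.

Lemma ideal_sum (T : eqType) (s : seq T) (P : pred T) (F : T -> {mpoly k[n]}) :
  (forall x, x \in s -> P x -> J (F x)) -> J (\sum_(x <- s | P x) F x).
Proof.
move=> JF; rewrite big_seq_cond.
by elim/big_ind: _ => [|*|x /andP[/JF]]; [exact: ideal0|exact: idealD|].
Qed.

End Ideals.

(** The exponents of the monomials in [init_ideal lt G]. Equality of truncated
    initial ideals amounts to equivalences between such sets of exponents
    ([trunc_init_idealP]), and all comparisons are made at that level. *)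
Definition initial_mon (k : fieldType) n (lt : rel (multinom n))
    (G : set {mpoly k[n]}) : set (multinom n) :=
  [set m | exists g, [/\ G g, g != 0 & lem (init_mon lt g) m]].

Section InitialMonomials.
Variables (k : fieldType) (n : nat) (lt : rel (multinom n)).
Hypothesis ltO : total_mult_order lt.
Implicit Types (f g : {mpoly k[n]}) (m u : multinom n) (J G : set {mpoly k[n]}).

Lemma initial_mon_up G m u : initial_mon lt G m -> lem m u -> initial_mon lt G u.
Proof. by case=> g [Gg g0 gm] mu; exists g; split=> //; exact: lepm_trans mu. Qed.

Lemma initial_mon_init G g : G g -> g != 0 -> initial_mon lt G (init_mon lt g).
Proof. by move=> Gg g0; exists g; split=> //; exact: lepm_refl. Qed.

(** A monomial ideal contains a polynomial iff it contains all its monomials. *)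
Lemma init_idealE G f :
  init_ideal lt G f <-> forall m, m \in msupp f -> initial_mon lt G m.
Proof.
split=> [|Gf].
  move: f; apply: (@ideal_gen_sub _ _ _
    [set f | forall m, m \in msupp f -> initial_mon lt G m])
    => [|_ [g [Gg /eqP g0] <-] m]; last first.
    rewrite /init_term => /msuppZ_le; rewrite msuppX inE => /eqP->.
    exact: initial_mon_init.
  split=> [m|p q Hp Hq m|p q Hq m]; first by rewrite msupp0.
    by move=> /msuppD_le; rewrite mem_cat => /orP[/Hp|/Hq].
  move=> /msuppM_le/allpairsP[[u v] /= [_ vq ->]].
  by apply: (initial_mon_up (Hq v vq)); exact: lem_addl.
have sG := @ideal_genS k n [set init_term lt g | g in G `\ 0].
have := ideal_genP [set init_term lt g | g in G `\ 0].
rewrite /init_ideal; move: (ideal_gen _) sG => J sG iG.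
rewrite (mpolyE f); apply: (ideal_sum iG) => m mf _ /=.
have [g [Gg g0 /lemP[u ->]]] := Gf m mf.
have c0 : init_coef lt g != 0 by rewrite -mcoeff_msupp; exact: (init_mon_supp ltO).
rewrite mpolyXD -[X in _ *: (_ * X)](scalerK c0).
apply: idealZ => //; apply: idealM => //; apply: idealZ => //; apply: sG.
by exists g => //; split=> //; exact/eqP.
Qed.

(** Multiplying by a monomial shifts the initial monomial, so for an ideal
    divisibility by an initial monomial can be replaced by equality. *)
Lemma initial_mon_ideal J m : is_ideal J -> initial_mon lt J m ->
  exists f, [/\ J f, f != 0 & init_mon lt f = m].
Proof.
move=> iJ [g [Jg g0 /lemP[u ->]]]; exists (mpolyX k u * g); split.
- exact: idealM.
- apply: contraTneq (init_mon_supp ltO g0) => /(congr1 (mcoeff (mnm_add u (init_mon lt g)))).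
  by rewrite (mulrC (mpolyX k u)) mcoeffMX mcoeff0 mcoeff_msupp => ->; rewrite eqxx.
- exact: init_monMX.
Qed.

Variables (A : zmodType) (a : 'I_n -> A).

Lemma mcoeff_hcomp s f m :
  mcoeff m (hcomp a s f) = if wdeg a m == s then mcoeff m f else 0.
Proof. exact: mcoeff_restrict. Qed.

Lemma msupp_hcomp s f m :
  (m \in msupp (hcomp a s f)) = (wdeg a m == s) && (m \in msupp f).
Proof. exact: msupp_restrict. Qed.

(** Take the homogeneous component that contains the initial monomial, and
    normalize its leading coefficient. *)
Lemma initial_mon_homog J m : is_ideal J -> homogeneous a J ->
  initial_mon lt J m ->
  exists f, [/\ J f, homog a (wdeg a m) f, mcoeff m f = 1 & init_mon lt f = m].
Proof.
move=> iJ hJ /(initial_mon_ideal iJ)[f [Jf f0 fm]].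
have [+ maxf] := init_monP ltO f0; rewrite fm => mf.
have c0 : mcoeff m f != 0 by rewrite -mcoeff_msupp.
exists ((mcoeff m f)^-1 *: hcomp a (wdeg a m) f); split.
- by apply: idealZ => //; exact: hJ.
- by move=> u /msuppZ_le; rewrite msupp_hcomp => /andP[/eqP].
- by rewrite mcoeffZ mcoeff_hcomp eqxx mulVf.
- apply: init_mon_unique => // [|u /msuppZ_le].
    by rewrite mcoeff_msupp mcoeffZ mcoeff_hcomp eqxx mulVf // oner_eq0.
  by rewrite msupp_hcomp => /andP[_ uf]; rewrite -fm; exact: maxf.
Qed.

End InitialMonomials.

Section Truncation.
Variables (k : fieldType) (n : nat) (A : zmodType) (a : 'I_n -> A) (Omega : set A).
Implicit Types (f g : {mpoly k[n]}) (m u : multinom n) (J G : set {mpoly k[n]}).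

Lemma trunc_init_idealE lt G f : total_mult_order lt ->
  trunc a Omega (init_ideal lt G) f <->
  forall m, m \in msupp f -> Omega (wdeg a m) /\ initial_mon lt G m.
Proof.
move=> ltO; split=> [[Gf Of] m mf|Gf].
  split; first exact: Of.
  have /(init_idealE ltO)/(_ m) := Gf (wdeg a m).
  by rewrite msupp_hcomp eqxx; exact.
split=> [s|m /Gf[]//]; apply/(init_idealE ltO) => m.
by rewrite msupp_hcomp => /andP[_ /Gf[]].
Qed.

Lemma trunc_init_idealP lt lt' G G' :
  total_mult_order lt -> total_mult_order lt' ->
  trunc a Omega (init_ideal lt G) = trunc a Omega (init_ideal lt' G') <->
  forall m, Omega (wdeg a m) -> initial_mon lt G m <-> initial_mon lt' G' m.
Proof.
move=> ltO ltO'; split=> [E m Om|E].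
  have H : trunc a Omega (init_ideal lt G) (mpolyX k m) <->
           trunc a Omega (init_ideal lt' G') (mpolyX k m) by rewrite E.
  rewrite !trunc_init_idealE // in H.
  have mX : m \in msupp (mpolyX k m) by rewrite msuppX mem_head.
  by split=> im; [apply: (H.1 _ m mX).2|apply: (H.2 _ m mX).2] => u;
    rewrite msuppX inE => /eqP->.
apply/seteqP; split=> f /trunc_init_idealE H; apply/trunc_init_idealE => // m mf;
  by have [] := H _ m mf => // Om; split=> //; apply/(E m Om).
Qed.

End Truncation.

(** * Normal forms *)

Section NormalForms.
Variables (k : fieldType) (n : nat) (A : zmodType) (a : 'I_n -> A).
Variables (J : set {mpoly k[n]}) (s : A) (S : seq (multinom n)).
Hypothesis iJ : is_ideal J.
Hypothesis hJ : homogeneous a J.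
Hypothesis Sfin : forall m, wdeg a m = s -> m \in S.
Implicit Types (f g q r : {mpoly k[n]}) (m u : multinom n).

(** The last clause bounds the terms of the remainder by those of [f]; for an
    ordering modified by a weight it says that weights do not increase. *)
Definition reduces_to (lt : rel (multinom n)) f r : Prop :=
  [/\ J (f - r), homog a s r, forall m, m \in msupp r -> ~ initial_mon lt J m
    & forall m, m \in msupp r -> exists2 m', m' \in msupp f & m = m' \/ lt m m'].

Lemma reduces_to_linear lt f :
  (forall m, m \in msupp f -> exists r, reduces_to lt (mpolyX k m) r) ->
  exists r, reduces_to lt f r.
Proof.
move=> NF; have {NF} /choice[F NF] : forall m, exists r, m \in msupp f ->
    reduces_to lt (mpolyX k m) r.
  move=> m; have [/NF[r Hr]|_] := boolP (m \in msupp f); first by exists r.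
  by exists 0.
exists (\sum_(m <- msupp f) mcoeff m f *: F m).
have supp u : u \in msupp (\sum_(m <- msupp f) mcoeff m f *: F m) ->
    exists2 m, m \in msupp f & u \in msupp (F m).
  move=> /msupp_sum_le/flatten_mapP[m]; rewrite filter_predT => mf /msuppZ_le uF.
  by exists m.
split=> [|u /supp[m mf]|u /supp[m mf]|u /supp[m mf]].
- rewrite [X in X - _]mpolyE -sumrB; apply: ideal_sum => // m mf _.
  by rewrite -scalerBr; apply: idealZ => //; case: (NF m mf).
- by case: (NF m mf) => _ + _ _; exact.
- by case: (NF m mf) => _ _ + _; exact.
case: (NF m mf) => _ _ _ H /H[m']; rewrite msuppX inE => /eqP-> um.
by exists m.
Qed.

Variable lt : rel (multinom n).
Hypothesis ltO : total_mult_order lt.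

Lemma count_lt_ltn m u : u \in S -> lt u m -> (count (lt^~ u) S < count (lt^~ m) S)%N.
Proof.
move=> uS um; apply: (@leq_trans (count (predU (pred1 u) (lt^~ u)) S)).
  have := count_predUI (pred1 u) (lt^~ u) S.
  rewrite (@eq_count _ (predI _ _) pred0) => [|v /=]; last first.
    by case: eqP => // ->; rewrite tmo_irr.
  by rewrite count_pred0 addn0 => ->; rewrite -add1n leq_add2r -has_count has_pred1.
by apply: sub_count => v /= /orP[/eqP->//|vu]; exact: tmo_trans vu um.
Qed.

(** The ordering need not be a well-ordering, but only the finitely many
    monomials of degree [s] occur: induction on the number of those below [m].
    An initial monomial [m] is replaced by the lower terms of a monic element
    of [J] with initial monomial [m]. *)
Lemma reduces_to_exists f : homog a s f -> exists r, reduces_to lt f r.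
Proof.
suff NF m : wdeg a m = s -> exists r, reduces_to lt (mpolyX k m) r.
  by move=> hf; apply: reduces_to_linear => m mf; apply: NF; exact: hf.
have [d] := ubnP (count (lt^~ m) S); elim: d m => // d IH m ltd ms.
have [im|nim] := pselect (initial_mon lt J m); last first.
  exists (mpolyX k m); split=> [|u|u|u].
  - by rewrite subrr; exact: ideal0.
  - by rewrite msuppX inE => /eqP->.
  - by rewrite msuppX inE => /eqP->.
  - by exists u => //; left.
have [g [Jg hg gm1 gm]] := initial_mon_homog ltO iJ hJ im.
have g0 : g != 0 by apply/eqP => g0; move: gm1 => /esym/eqP; rewrite g0 mcoeff0 oner_eq0.
have [_ maxg] := init_monP ltO g0; rewrite gm in maxg.
have supp u : u \in msupp (mpolyX k m - g) -> u \in msupp g /\ lt u m.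
  move=> uq; have um : u != m.
    apply: contraTneq uq => ->.
    by rewrite mcoeff_msupp mcoeffB mcoeffX eqxx gm1 subrr eqxx.
  have ug : u \in msupp g.
    by move/msuppB_le: uq; rewrite mem_cat msuppX inE (negPf um).
  by split=> //; exact: maxg.
have [|r [Jr hr rn rle]] := @reduces_to_linear lt (mpolyX k m - g).
  move=> u /supp[ug um]; apply: IH; last by rewrite (hg _ ug).
  apply: leq_trans (count_lt_ltn _ um) _; last by rewrite -ltnS.
  by apply: Sfin; rewrite (hg _ ug).
exists r; split=> // [|u /rle[v /supp[_ vm] uv]].
  have -> : mpolyX k m - r = (mpolyX k m - g - r) + g by rewrite addrAC subrK.
  exact: idealD.
exists m; first by rewrite msuppX mem_head.
right; case: uv => [->//|uv]; exact: tmo_trans uv vm.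
Qed.

End NormalForms.

(** * Comparison of initial ideals for two orderings *)

Section Comparison.
Variables (k : fieldType) (n : nat) (A : zmodType) (a : 'I_n -> A).
Variables (J : set {mpoly k[n]}) (lt lt' : rel (multinom n)).
Hypotheses (iJ : is_ideal J) (hJ : homogeneous a J).
Hypotheses (ltO : total_mult_order lt) (ltO' : total_mult_order lt').
Implicit Types (f g q r : {mpoly k[n]}) (m u : multinom n).

(** If [m] were initial for [lt'] only, its normal form for [lt'] would be a
    combination of monomials standard for [lt'], hence for [lt]. Then [m] minus
    this normal form is a nonzero element of [J] all of whose monomials are
    standard for [lt], which is absurd. *)
Lemma initial_mon_le_eq (s : A) : positively_graded k a ->
  (forall m, wdeg a m = s -> initial_mon lt J m -> initial_mon lt' J m) ->
  forall m, wdeg a m = s -> initial_mon lt' J m -> initial_mon lt J m.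
Proof.
move=> pg sub m ms im'; apply: contrapT => nim.
have [S Sfin] := positively_graded_finite pg s.
have [|r [Jr hr rn _]] := reduces_to_exists iJ hJ Sfin ltO' (f := mpolyX k m).
  by move=> u; rewrite msuppX inE => /eqP->.
have f0 : mpolyX k m - r != 0.
  apply/eqP => /(congr1 (mcoeff m)).
  have -> : mcoeff m (mpolyX k m - r) = 1.
    rewrite mcoeffB mcoeffX eqxx; have [/rn//|] := boolP (m \in msupp r).
    by rewrite -mcoeff_eq0 => /eqP->; rewrite subr0.
  by rewrite mcoeff0 => /eqP; rewrite oner_eq0.
have iu := initial_mon_init lt Jr f0.
have /msuppB_le := init_mon_supp ltO f0.
rewrite mem_cat msuppX inE => /orP[/eqP um|ur]; first by rewrite um in iu.
by apply: (rn _ ur); apply: sub => //; exact: hr.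
Qed.

End Comparison.

(** * Reduced bases: uniqueness and existence *)

Section GroebnerBases.
Variables (k : fieldType) (n : nat) (A : zmodType) (a : 'I_n -> A) (Omega : set A).
Variables (lt : rel (multinom n)) (J : set {mpoly k[n]}).
Hypotheses (ltO : total_mult_order lt) (iJ : is_ideal J) (hJ : homogeneous a J).
Implicit Types (f g q r : {mpoly k[n]}) (m u : multinom n) (G : set {mpoly k[n]}).

Lemma groebner_basisI G : finite_set G -> G `<=` J ->
  (forall g, G g -> g != 0 /\ exists2 s, Omega s & homog a s g) ->
  (forall m, Omega (wdeg a m) -> initial_mon lt J m -> initial_mon lt G m) ->
  groebner_basis a Omega lt J G.
Proof.
move=> fG GJ Gh Jm; split=> //; apply/trunc_init_idealP => // m Om.
split=> [|[g [Gg g0 gm]]]; first exact: Jm.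
by exists g; split=> //; exact: GJ.
Qed.

Lemma groebner_basis_div G m : groebner_basis a Omega lt J G ->
  Omega (wdeg a m) -> initial_mon lt J m -> initial_mon lt G m.
Proof. by case=> _ _ _ /trunc_init_idealP E Om; apply: (E _ _ _ Om).1. Qed.

Lemma groebner_basis_homog G g m : groebner_basis a Omega lt J G -> G g ->
  m \in msupp g -> Omega (wdeg a m).
Proof. by case=> _ _ + _ Gg mg => /(_ g Gg)[_ [s Os /(_ m mg)->]]. Qed.

Lemma groebner_basis_neq0 G g : groebner_basis a Omega lt J G -> G g -> g != 0.
Proof. by case=> _ _ + _ Gg => /(_ g Gg)[]. Qed.

Lemma reduced_tail G g m : reduced_groebner_basis a Omega lt J G -> G g ->
  m \in msupp g -> m != init_mon lt g -> ~ initial_mon lt J m.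
Proof.
move=> [gb _ red tail] Gg mg mi /(groebner_basis_div gb (groebner_basis_homog gb Gg mg)).
case=> g' [Gg' _ g'm]; have [gg'|gg'] := eqVneq g' g.
  by move: (tail g m Gg mg mi); rewrite -gg' g'm.
by move: (red g' g m Gg' Gg (elimN eqP gg') mg); rewrite g'm.
Qed.

Lemma reduced_init_inj G g g' : reduced_groebner_basis a Omega lt J G ->
  G g -> G g' -> lem (init_mon lt g') (init_mon lt g) -> g' = g.
Proof.
move=> [gb _ red _] Gg Gg' dv; apply: contrapT => gg'.
have ig := init_mon_supp ltO (groebner_basis_neq0 gb Gg).
by move: (red g' g _ Gg' Gg gg' ig); rewrite dv.
Qed.

(** The initial monomial of [g] in [G] is divisible by that of some [g'] in [G'],
    which is divisible by that of some element of [G]; reducedness makes all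
    three equal. Then [g - g'] is in [J] and has only standard monomials. *)
Lemma reduced_groebner_basis_sub G G' :
  reduced_groebner_basis a Omega lt J G ->
  reduced_groebner_basis a Omega lt J G' -> G `<=` G'.
Proof.
move=> rG rG' g Gg.
have [gb monic _ _] := rG; have [gb' monic' _ _] := rG'.
have JG : G `<=` J by case: gb.
have JG' : G' `<=` J by case: gb'.
have g0 := groebner_basis_neq0 gb Gg; have ig := init_mon_supp ltO g0.
have Oig := groebner_basis_homog gb Gg ig.
have [g' [Gg' g0' dv]] := groebner_basis_div gb' Oig (initial_mon_init lt (JG _ Gg) g0).
have ig' := init_mon_supp ltO g0'.
have [g2 [Gg2 g02 dv2]] := groebner_basis_div gb (groebner_basis_homog gb' Gg' ig')
  (initial_mon_init lt (JG' _ Gg') g0').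
have g2E := reduced_init_inj rG Gg Gg2 (lepm_trans dv2 dv); rewrite g2E in dv2.
have iE := lem_anti dv2 dv.
suff /eqP : g - g' == 0 by move=> /subr0_eq->.
apply: contrapT => /negP d0.
have idJ : initial_mon lt J (init_mon lt (g - g')).
  by apply: initial_mon_init => //; apply: idealB => //; [exact: JG|exact: JG'].
(* both elements are monic, so their leading terms cancel *)
have ni : init_mon lt (g - g') != init_mon lt g.
  apply: contraTneq (init_mon_supp ltO d0) => ->.
  rewrite mcoeff_msupp mcoeffB {2}iE.
  have := monic _ Gg; have := monic' _ Gg'; rewrite /init_coef => -> ->.
  by rewrite subrr eqxx.
have /msuppB_le := init_mon_supp ltO d0; rewrite mem_cat => /orP[dg|dg'].
  exact: reduced_tail rG Gg dg ni idJ.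
by apply: reduced_tail rG' Gg' dg' _ idJ; rewrite -iE.
Qed.

Lemma reduced_groebner_basis_uniq G G' :
  reduced_groebner_basis a Omega lt J G ->
  reduced_groebner_basis a Omega lt J G' -> G = G'.
Proof. by move=> rG rG'; apply/seteqP; split; exact: reduced_groebner_basis_sub. Qed.

(** The minimal initial monomials with degree in [Omega] are finite in number by
    Dickson's lemma; each of them minus its normal form is a basis element. *)
Lemma reduced_groebner_basis_exists : positively_graded k a ->
  exists G, reduced_groebner_basis a Omega lt J G.
Proof.
move=> pg; pose P := [set m | Omega (wdeg a m) /\ initial_mon lt J m].
pose M := [set b | P b /\ forall u, P u -> lem u b -> u = b].
have [B [BM Bm]] := dickson M.
have MB m : M m -> m \in B.
  by move=> Mm; have [b bB bm] := Bm m Mm; rewrite -(Mm.2 b (BM b bB).1 bm).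
have /choice[r Hr] : forall m, exists r, reduces_to a J (wdeg a m) lt (mpolyX k m) r.
  move=> m; have [S HS] := positively_graded_finite pg (wdeg a m).
  by apply: (reduces_to_exists iJ hJ HS) => // u; rewrite msuppX inE => /eqP->.
pose g m := mpolyX k m - r m.
have Mr m u : M m -> u \in msupp (r m) -> u != m.
  move=> [[_ im] _] ur; apply: contraTneq ur => ->; apply/negP.
  by case: (Hr m) => _ _ + _ => /[apply].
have gm m : M m -> mcoeff m (g m) = 1.
  move=> Mm; rewrite mcoeffB mcoeffX eqxx.
  have -> : mcoeff m (r m) = 0; last by rewrite subr0.
  by apply/eqP; rewrite mcoeff_eq0; apply/negP => /(Mr _ _ Mm); rewrite eqxx.
have supp m u : u \in msupp (g m) -> u = m \/ u \in msupp (r m).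
  by move/msuppB_le; rewrite mem_cat msuppX inE => /orP[/eqP|]; [left|right].
have gi m : M m -> init_mon lt (g m) = m.
  move=> Mm; apply: init_mon_unique => // [|u /supp[->|ur]]; rewrite ?eqxx //.
    by rewrite mcoeff_msupp gm // oner_eq0.
  move=> _; case: (Hr m) => _ _ _ /(_ u ur)[v].
  rewrite msuppX inE => /eqP-> [um|//].
  by have := Mr _ _ Mm ur; rewrite um eqxx.
have g0 m : M m -> g m != 0.
  by move=> /gm gm1; apply/eqP => g0; move/eqP: gm1; rewrite g0 mcoeff0 eq_sym oner_eq0.
have rni m u : u \in msupp (r m) -> ~ initial_mon lt J u by case: (Hr m) => _ _ + _; exact.
exists [set g m | m in M]; split.
- apply: groebner_basisI.
  + apply: finite_image; apply: (@sub_finite_set _ _ [set` B]) => [m /MB//|].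
    exact: finite_seq.
  + by move=> _ [m Mm <-]; case: (Hr m).
  + move=> _ [m Mm <-]; split; first exact: g0.
    exists (wdeg a m) => [|u /supp[->//|ur]]; first by case: Mm => -[].
    by case: (Hr m) => _ + _ _; exact.
  + move=> m Om im; have [b [Pb bm bmin]] := minimal_divisor (conj Om im : P m).
    exists (g b); split=> //; first by exists b.
      exact: g0.
    by rewrite gi.
- by move=> _ [m Mm <-]; rewrite /init_coef gi // gm.
- move=> _ _ u [m Mm <-] [m' Mm' <-] gg' /supp[->|ur]; rewrite gi //; apply/negP.
    by move=> mm'; apply: gg'; rewrite (Mm'.2 m Mm.1).
  move=> mu; apply: (rni _ _ ur); apply: initial_mon_up mu.
  by case: Mm => -[].
- move=> _ u [m Mm <-]; rewrite gi // => /supp[->|ur]; first by rewrite eqxx.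
  move=> _; apply/negP => mu; apply: (rni _ _ ur); apply: initial_mon_up mu.
  by case: Mm => -[].
Qed.

End GroebnerBases.

(** * Initial forms with respect to a weight vector *)

Section Weights.
Variables (k : fieldType) (n : nat) (R : realType) (eta : 'rV[R]_n).
Implicit Types (f g h : {mpoly k[n]}) (m u : multinom n) (J : set {mpoly k[n]}) (c : R).

Lemma wdotD u m : wdot eta (mnm_add u m) = wdot eta u + wdot eta m.
Proof.
by rewrite /wdot -big_split /=; apply: eq_bigr => i _; rewrite mnmDE natrD mulrDr.
Qed.

Lemma modified_tmo lt : total_mult_order lt -> total_mult_order (modified lt eta).
Proof.
move=> ltO; split=> [u|v u m|u v uv|u v m]; rewrite /modified.
- by rewrite ltxx eqxx tmo_irr.
- move=> /orP[uv|/andP[/eqP-> uv]] /orP[vm|/andP[/eqP<- vm]].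
  + by rewrite (lt_trans uv vm).
  + by rewrite uv.
  + by rewrite vm.
  + by rewrite eqxx (tmo_trans ltO uv vm) orbT.
- by case: (ltgtP (wdot eta u) (wdot eta v)) => //= _; exact: tmo_total.
- rewrite !(addmC _ m) !wdotD ltrD2l (inj_eq (addrI _)).
  by move=> /orP[->//|/andP[-> uv]]; rewrite (tmo_add ltO m uv) orbT.
Qed.

Lemma modified_represented lt u m : represented_by lt eta -> modified lt eta u m -> lt u m.
Proof. by move=> rep /orP[/rep|/andP[]]. Qed.

Lemma mcoeff_init_form f m : mcoeff m (init_form eta f) =
  if all (fun m' => wdot eta m' <= wdot eta m) (msupp f) then mcoeff m f else 0.
Proof. exact: (mcoeff_restrict (fun m => all (fun m' => wdot eta m' <= wdot eta m) _)). Qed.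

Lemma msupp_init_form f m : (m \in msupp (init_form eta f)) =
  all (fun m' => wdot eta m' <= wdot eta m) (msupp f) && (m \in msupp f).
Proof. exact: (msupp_restrict (fun m => all (fun m' => wdot eta m' <= wdot eta m) _)). Qed.

Lemma seq_argmax (s : seq (multinom n)) : s != [::] ->
  exists2 m, m \in s & all (fun u => wdot eta u <= wdot eta m) s.
Proof.
elim: s => // x s IH _; have [->|/IH[m ms mx]] := eqVneq s [::].
  by exists x; rewrite ?mem_head //= lexx.
have [xm|mx'] := leP (wdot eta x) (wdot eta m).
  by exists m; rewrite ?inE ?ms ?orbT //= xm.
exists x; rewrite ?mem_head //= lexx /=; apply: sub_all mx => u um.
exact: le_trans um (ltW mx').
Qed.

Lemma init_form_neq0 f : f != 0 -> init_form eta f != 0.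
Proof.
rewrite -!msupp_eq0 => /seq_argmax[m mf mmax].
have : m \in msupp (init_form eta f) by rewrite msupp_init_form mmax.
by case: (msupp _).
Qed.

Definition wcomp c f : {mpoly k[n]} :=
  \sum_(m <- msupp f | wdot eta m == c) mcoeff m f *: mpolyX k m.

Lemma mcoeff_wcomp c f m :
  mcoeff m (wcomp c f) = if wdot eta m == c then mcoeff m f else 0.
Proof. exact: (mcoeff_restrict (fun m => wdot eta m == c)). Qed.

Lemma sum_wcomp f :
  f = \sum_(c <- undup [seq wdot eta m | m <- msupp f]) wcomp c f.
Proof.
apply/mpolyP => m; rewrite raddf_sum /=.
under eq_bigr do rewrite mcoeff_wcomp.
have [mf|mf] := boolP (m \in msupp f); last first.
  have /eqP-> : mcoeff m f == 0 by rewrite mcoeff_eq0.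
  by rewrite big1 // => c _; rewrite if_same.
rewrite (bigD1_seq (wdot eta m)) ?undup_uniq //=; last first.
  by rewrite mem_undup; apply/mapP; exists m.
by rewrite eqxx big1 ?addr0 // => c; rewrite eq_sym => /negPf->.
Qed.

(** The part of weight [c] of [h] is either 0 or the initial form of an element
    of [J]. Only coefficients are compared, so that the case of a vanishing part
    needs no separate treatment. *)
Definition top_part J c h : Prop :=
  exists f, [/\ J f, forall m, m \in msupp f -> wdot eta m <= c
    & forall m, wdot eta m = c -> mcoeff m f = mcoeff m h].

Lemma mcoeffXM u f m :
  mcoeff m (mpolyX k u * f) = if lem u m then mcoeff (mnm_sub m u) f else 0.
Proof.
rewrite (mulrC (mpolyX k u)); case: ifP => [um|um].
  by rewrite -{1}(submK um) addmC mcoeffMX.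
apply/eqP; rewrite mcoeff_eq0 (perm_mem (msuppMX f u)).
by apply: contraFN um => /mapP[v _ ->]; exact: lem_addr.
Qed.

Variable J : set {mpoly k[n]}.
Hypothesis iJ : is_ideal J.

Lemma top_parts_ideal : is_ideal [set h | forall c, top_part J c h].
Proof.
have J0 := ideal0 iJ.
have tD f g : (forall c, top_part J c f) -> (forall c, top_part J c g) ->
    forall c, top_part J c (f + g).
  move=> tf tg c; have [f' [Jf fc fE]] := tf c; have [g' [Jg gc gE]] := tg c.
  exists (f' + g'); split=> [|m|m mc]; first exact: idealD.
    by move=> /msuppD_le; rewrite mem_cat => /orP[/fc|/gc].
  by rewrite !mcoeffD fE // gE.
have t0 c : top_part J c 0 by exists 0; split=> // m; rewrite msupp0.
split=> //= p h th; rewrite (mpolyE p) mulr_suml.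
elim/big_ind: _ => // u _ c; rewrite -scalerAl.
have [f [Jf fc fE]] := th (c - wdot eta u).
exists (mcoeff u p *: (mpolyX k u * f)); split=> [|m|m mc].
- by apply: idealZ => //; exact: idealM.
- move=> /msuppZ_le; rewrite mcoeff_msupp mcoeffXM; case: ifP => [um|]; last by rewrite eqxx.
  rewrite -mcoeff_msupp => /fc; rewrite lerBrDr -wdotD.
  by rewrite submK.
- rewrite !mcoeffZ !mcoeffXM; case: ifP => // um; rewrite fE //.
  by rewrite -mc -[in RHS](submK um) wdotD addrK.
Qed.

(** The polynomials with this property form an ideal that contains the initial
    forms; conversely such an [h] is the sum of its weight components, and each
    nonzero one is the initial form of its witness. *)
Lemma init_form_idealE h :
  init_form_ideal eta J h <-> forall c, top_part J c h.
Proof.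
split=> [|th].
  move: h; apply: (@ideal_gen_sub _ _ _ [set h | forall c, top_part J c h]).
    exact: top_parts_ideal.
  move=> _ [f [Jf /eqP f0] <-] c; rewrite -msupp_eq0 in f0.
  have [m0 m0f m0max] := seq_argmax f0.
  have [cE|cm0] := eqVneq c (wdot eta m0).
    exists f; split=> // [m mf|m mc]; first by rewrite cE; exact: (allP m0max).
    by rewrite mcoeff_init_form mc cE m0max.
  exists 0; split=> [|m|m mc]; [exact: ideal0|by rewrite msupp0|].
  rewrite mcoeff0; apply/esym/eqP; rewrite mcoeff_eq0 msupp_init_form.
  apply: contraNN cm0 => /andP[/allP/(_ _ m0f) le1 mf].
  by rewrite -mc eq_le le1 (allP m0max _ mf).
have sK := @ideal_genS k n [set init_form eta f | f in J `\ 0].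
have := ideal_genP [set init_form eta f | f in J `\ 0].
rewrite /init_form_ideal; move: (ideal_gen _) sK => K sK iK.
rewrite (sum_wcomp h); apply: ideal_sum => // c.
rewrite mem_undup => /mapP[m0 m0h cE] _.
have [f [Jf fc fE]] := th c.
have m0f : m0 \in msupp f by rewrite mcoeff_msupp fE // -mcoeff_msupp.
have -> : wcomp c h = init_form eta f.
  apply/mpolyP => m; rewrite mcoeff_wcomp mcoeff_init_form.
  case: eqP => [mc|mc].
    by rewrite (_ : all _ _) ?fE //; apply/allP => u /fc; rewrite mc.
  case: allP => // mmax; have [mf|] := boolP (m \in msupp f); last first.
    by rewrite -mcoeff_eq0 => /eqP->.
  by case: mc; apply/eqP; rewrite eq_le fc // cE mmax.
apply: sK; exists f => //; split=> //; apply/eqP.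
by rewrite -msupp_eq0; case: (msupp f) m0f.
Qed.

Lemma wcomp_init_form_ideal c h :
  init_form_ideal eta J h -> init_form_ideal eta J (wcomp c h).
Proof.
move=> /init_form_idealE th; apply/init_form_idealE => d.
have [->|dc] := eqVneq d c.
  have [f [Jf fc fE]] := th c; exists f; split=> // m mc.
  by rewrite fE // mcoeff_wcomp mc eqxx.
exists 0; split=> [|m|m md]; [exact: ideal0|by rewrite msupp0|].
by rewrite mcoeff_wcomp md (negPf dc) mcoeff0.
Qed.

Lemma init_form_ideal_homogeneous (A : zmodType) (a : 'I_n -> A) :
  homogeneous a J -> homogeneous a (init_form_ideal eta J).
Proof.
move=> hJ h s /init_form_idealE th; apply/init_form_idealE => c.
have [f [Jf fc fE]] := th c; exists (hcomp a s f); split=> [|m|m mc].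
- exact: hJ.
- by rewrite msupp_hcomp => /andP[_ /fc].
- by rewrite !mcoeff_hcomp fE.
Qed.

Variable lt : rel (multinom n).
Hypothesis ltO : total_mult_order lt.

Lemma init_mon_init_form f : f != 0 ->
  init_mon lt (init_form eta f) = init_mon (modified lt eta) f.
Proof.
move=> f0; have [mf mmax] := init_monP (modified_tmo ltO) f0.
apply: init_mon_unique => // [|m].
  rewrite msupp_init_form mf andbT; apply/allP => u uf.
  have [->//|um] := eqVneq u (init_mon (modified lt eta) f).
  by have /orP[/ltW|/andP[/eqP->]] := mmax u uf um.
rewrite msupp_init_form => /andP[/allP/(_ _ mf) le1 uf um].
by have /orP[|/andP[]] := mmax m uf um; rewrite // ltNge le1.
Qed.

Lemma mcoeff_init_mon_init_form f : f != 0 ->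
  mcoeff (init_mon (modified lt eta) f) (init_form eta f) =
  mcoeff (init_mon (modified lt eta) f) f.
Proof.
move=> f0; have [mf mmax] := init_monP (modified_tmo ltO) f0.
rewrite mcoeff_init_form (_ : all _ _) //; apply/allP => u uf.
have [->//|um] := eqVneq u (init_mon (modified lt eta) f).
by have /orP[/ltW|/andP[/eqP->]] := mmax u uf um.
Qed.

Lemma init_form_ideal_mem f : J f -> f != 0 -> init_form_ideal eta J (init_form eta f).
Proof. by move=> Jf f0; apply: ideal_genS; exists f => //; split=> //; exact/eqP. Qed.

(** If [m] is the initial monomial of [h] in in_eta(J), the witness for the part
    of [h] of the weight of [m] has initial monomial [m] for the modified
    ordering. *)
Lemma initial_mon_init_form_ideal m :
  initial_mon lt (init_form_ideal eta J) m <-> initial_mon (modified lt eta) J m.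
Proof.
have mO := modified_tmo ltO.
split.
  move=> /(initial_mon_ideal ltO (ideal_genP _))[h [Ih h0 hm]].
  have [mh mmax] := init_monP ltO h0; rewrite hm in mh mmax.
  have /init_form_idealE/(_ (wdot eta m))[f [Jf fc fE]] := Ih.
  have mf : m \in msupp f by rewrite mcoeff_msupp fE // -mcoeff_msupp.
  have f0 : f != 0 by rewrite -msupp_eq0; case: (msupp f) mf.
  suff <- : init_mon (modified lt eta) f = m by exact: initial_mon_init.
  apply: init_mon_unique => // u uf um; rewrite /modified.
  have := fc u uf; rewrite le_eqVlt => /orP[/eqP uE|->//].
  by rewrite uE eqxx mmax ?orbT // mcoeff_msupp -fE // -mcoeff_msupp.
move=> /(initial_mon_ideal mO iJ)[f [Jf f0 <-]].
rewrite -init_mon_init_form //; apply: initial_mon_init.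
  exact: init_form_ideal_mem.
exact: init_form_neq0.
Qed.

End Weights.

(** * Weights in the closure of a cell *)

Section Cells.
Variables (k : fieldType) (n : nat) (A : zmodType) (a : 'I_n -> A) (Omega : set A).
Variables (R : realType) (I : set {mpoly k[n]}).
Hypotheses (iI : is_ideal I) (hI : homogeneous a I).
Implicit Types (f g h : {mpoly k[n]}) (m u : multinom n) (v w : 'rV[R]_n).

Lemma wdot_continuous m : continuous (fun v => wdot v m).
Proof.
apply: continuous_big => [|i _ v]; first exact: add_continuous.
exact: (continuous_comp (@coord_continuous R 1 n ord0 i v)
  (@mulrr_continuous _ (m i)%:R _)).
Qed.

Lemma closure_wdot_le (C : set 'rV[R]_n) u m w :
  (forall v, C v -> wdot v u <= wdot v m) -> closure C w -> wdot w u <= wdot w m.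
Proof.
move=> Cle Cw; rewrite -subr_ge0.
pose F v := wdot v m - wdot v u.
have cF : closed (F @^-1` [set x | 0 <= x]).
  apply: preimage_closed; last exact: closed_ge.
  by move=> v _; apply: continuousB; exact: wdot_continuous.
have : closure (F @^-1` [set x | 0 <= x]) w.
  by apply: closureS Cw => v /Cle; rewrite -subr_ge0.
by rewrite -((closure_id _).1 cF).
Qed.

Lemma trunc_eq_initial_mon lt (J J' : set {mpoly k[n]}) m :
  total_mult_order lt -> is_ideal J -> homogeneous a J -> homogeneous a J' ->
  trunc a Omega J = trunc a Omega J' -> Omega (wdeg a m) ->
  initial_mon lt J m -> initial_mon lt J' m.
Proof.
move=> ltO iJ hJ hJ' JJ' Om /(initial_mon_homog ltO iJ hJ)[f [Jf hf fm1 fm]].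
have f0 : f != 0 by apply/eqP => f0; move/eqP: fm1; rewrite f0 mcoeff0 eq_sym oner_eq0.
have : trunc a Omega J f.
  by split=> [s|u /hf->//]; exact: hJ.
rewrite JJ' => -[Jf' _]; rewrite -fm; apply: initial_mon_init => //.
suff <- : hcomp a (wdeg a m) f = f by exact: Jf'.
apply/mpolyP => u; rewrite mcoeff_hcomp; case: eqP => // /eqP um.
apply/esym/eqP; rewrite mcoeff_eq0; apply: contraNN um => /hf/eqP//.
Qed.

Variables (lt : rel (multinom n)) (w1 w : 'rV[R]_n) (G : set {mpoly k[n]}).
Hypotheses (ltO : total_mult_order lt) (ltw1 : represented_by lt w1).
Hypothesis rG : reduced_groebner_basis a Omega lt I G.

Lemma modified_id : modified lt w1 = lt.
Proof.
apply/funext => u; apply/funext => m; apply/idP/idP; first exact: modified_represented.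
rewrite /modified => um; case: ltgtP => //= /ltw1 mu.
by case: (tmo_asym ltO um mu).
Qed.

(** in_{lt_v}(I) = in_lt(in_v(I)) = in_lt(in_w1(I)) = in_{lt_w1}(I) = in_lt(I)
    in the degrees of [Omega]. *)
Lemma cell_initial_mon v m : cell a Omega I w1 v -> Omega (wdeg a m) ->
  initial_mon (modified lt v) I m -> initial_mon lt I m.
Proof.
move=> vw1 Om /(initial_mon_init_form_ideal v iI ltO) iv.
rewrite -modified_id; apply/(initial_mon_init_form_ideal w1 iI ltO).
apply: trunc_eq_initial_mon vw1 Om iv => //; first exact: ideal_genP.
  exact: init_form_ideal_homogeneous.
exact: init_form_ideal_homogeneous.
Qed.

Let gb : groebner_basis a Omega lt I G. Proof. by case: rG. Qed.

Lemma cell_init_mon v g : cell a Omega I w1 v -> G g ->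
  init_mon (modified lt v) g = init_mon lt g.
Proof.
move=> vw1 Gg; have vO := modified_tmo v ltO.
have g0 := groebner_basis_neq0 gb Gg.
apply/eqP; apply: contrapT => /negP ni.
have mg := init_mon_supp vO g0.
apply: (reduced_tail ltO rG Gg mg ni).
apply: (cell_initial_mon vw1); first exact: groebner_basis_homog gb Gg mg.
by apply: initial_mon_init => //; case: gb => _ + _ _; exact.
Qed.

Hypothesis w1w : closure (cell a Omega I w1) w.

(** For [v] in the cell the initial monomial of [g] has maximal [v]-weight among
    the terms of [g]; this passes to the limit [w], where [lt] breaks the ties. *)
Lemma closure_cell_init_mon g : G g -> init_mon (modified lt w) g = init_mon lt g.
Proof.
move=> Gg; have g0 := groebner_basis_neq0 gb Gg.
have [mg mmax] := init_monP ltO g0.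
apply: init_mon_unique => // [|u ug um]; first exact: modified_tmo.
have : wdot w u <= wdot w (init_mon lt g).
  apply: closure_wdot_le w1w => v vw1.
  have := init_monP (modified_tmo v ltO) g0.
  rewrite cell_init_mon // => -[_ /(_ u ug um)].
  by move=> /orP[/ltW|/andP[/eqP->]].
by rewrite /modified le_eqVlt => /orP[/eqP->|->//]; rewrite eqxx mmax ?orbT.
Qed.

Hypothesis pg : positively_graded k a.

(** One inclusion is read off from the elements of [G]; the other follows since
    no strict inclusion between initial ideals is possible. *)
Lemma closure_cell_initial_mon m : Omega (wdeg a m) ->
  initial_mon (modified lt w) I m <-> initial_mon lt I m.
Proof.
have sub u : Omega (wdeg a u) -> initial_mon lt I u -> initial_mon (modified lt w) I u.
  move=> Ou /(groebner_basis_div ltO gb Ou)[g [Gg g0 gu]].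
  exists g; split=> //; first by case: gb => _ + _ _; exact.
  by rewrite closure_cell_init_mon.
move=> Om; split; last exact: sub.
apply: (initial_mon_le_eq iI hI ltO (modified_tmo w ltO) pg _ erefl) => u um.
by apply: sub; rewrite um.
Qed.

Lemma reduced_modified : reduced_groebner_basis a Omega (modified lt w) I G.
Proof.
case: rG => -[fG GI Gh _] monic red tail; split.
- apply: groebner_basisI => //; first exact: modified_tmo.
  move=> m Om /(closure_cell_initial_mon Om)/(groebner_basis_div ltO gb Om).
  by case=> g [Gg g0 gm]; exists g; rewrite closure_cell_init_mon.
- by move=> g Gg; rewrite /init_coef closure_cell_init_mon //; exact: monic.
- by move=> g g' m Gg; rewrite closure_cell_init_mon //; exact: red.
- by move=> g m Gg; rewrite closure_cell_init_mon //; exact: tail.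
Qed.

Lemma initial_mon_init_form_ideal_cell m : Omega (wdeg a m) ->
  initial_mon lt (init_form_ideal w I) m <-> initial_mon lt I m.
Proof.
move=> Om; rewrite initial_mon_init_form_ideal //; exact: closure_cell_initial_mon.
Qed.

Lemma reduced_init_form :
  reduced_groebner_basis a Omega lt (init_form_ideal w I) [set init_form w g | g in G].
Proof.
case: rG => -[fG GI Gh _] monic red tail.
have g0 g : G g -> g != 0 by move=> /Gh[].
have initE g : G g -> init_mon lt (init_form w g) = init_mon lt g.
  by move=> Gg; rewrite init_mon_init_form ?closure_cell_init_mon // g0.
have supp g m : m \in msupp (init_form w g) -> m \in msupp g.
  by rewrite msupp_init_form => /andP[].
split.
- apply: groebner_basisI => //.
  + exact: finite_image.
  + by move=> _ [g Gg <-]; apply: init_form_ideal_mem; [exact: GI|exact: g0].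
  + move=> _ [g Gg <-]; split; first by exact: init_form_neq0 (g0 _ Gg).
    by have [_ [s Os hs]] := Gh g Gg; exists s => // m /supp; exact: hs.
  + move=> m Om /(initial_mon_init_form_ideal_cell Om)/(groebner_basis_div ltO gb Om).
    case=> g [Gg gn0 gm]; exists (init_form w g); split; first by exists g.
      exact: init_form_neq0.
    by rewrite initE.
- move=> _ [g Gg <-]; rewrite /init_coef initE // -closure_cell_init_mon //.
  rewrite mcoeff_init_mon_init_form ?g0 // closure_cell_init_mon //; exact: monic.
- move=> _ _ m [g Gg <-] [g' Gg' <-] gg' /supp mg'; rewrite initE //.
  by apply: red mg' => // E; apply: gg'; rewrite E.
- move=> _ m [g Gg <-] /supp mg; rewrite initE //; exact: tail.
Qed.

End Cells.

(** * Lifting a basis of the ideal of initial forms *)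

Section Lifting.
Variables (k : fieldType) (n : nat) (A : zmodType) (a : 'I_n -> A) (Omega : set A).
Variables (R : realType) (I : set {mpoly k[n]}).
Hypotheses (iI : is_ideal I) (hI : homogeneous a I) (pg : positively_graded k a).
Implicit Types (f g h r : {mpoly k[n]}) (m u : multinom n) (v w : 'rV[R]_n).

Lemma is_normal_form_unique lt G f s r r' : total_mult_order lt ->
  groebner_basis a Omega lt I G -> Omega s -> homog a s f ->
  is_normal_form a lt I G f r -> is_normal_form a lt I G f r' -> r = r'.
Proof.
move=> ltO gb Os hf [Ir hr nr] [Ir' hr' nr']; apply: subr0_eq.
apply/eqP; apply: contrapT => /negP d0.
have Id : I (r - r').
  have -> : r - r' = (f - r') - (f - r) by rewrite opprB [RHS]addrC addrA subrK.
  exact: idealB.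
have := init_mon_supp ltO d0; set u := init_mon lt _ => ud.
have iu : initial_mon lt I u by exact: initial_mon_init.
have hu : wdeg a u = s.
  move/msuppB_le: ud; rewrite mem_cat => /orP[]; [exact: hr|exact: hr'].
have [|g [Gg _ gu]] := groebner_basis_div ltO gb _ iu; first by rewrite hu.
move/msuppB_le: ud; rewrite mem_cat => /orP[ur|ur].
  by move: (nr g u Gg ur); rewrite gu.
by move: (nr' g u Gg ur); rewrite gu.
Qed.

Variables (lt lt' : rel (multinom n)) (w1 w : 'rV[R]_n) (G H : set {mpoly k[n]}).
Hypotheses (ltO : total_mult_order lt) (ltO' : total_mult_order lt').
Hypothesis ltw1 : represented_by lt w1.
Hypothesis rG : reduced_groebner_basis a Omega lt I G.
Hypothesis w1w : closure (cell a Omega I w1) w.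
Hypothesis rH : reduced_groebner_basis a Omega lt' (init_form_ideal w I) H.

Let gbG : groebner_basis a Omega lt I G. Proof. by case: rG. Qed.
Let gbH : groebner_basis a Omega lt' (init_form_ideal w I) H. Proof. by case: rH. Qed.
Let iK : is_ideal (init_form_ideal w I). Proof. exact: ideal_genP. Qed.

(** The elements of [H] are homogeneous for the weight [w]: a weight component
    of [f] without the initial term would still be in in_w(I), and its initial
    monomial would be a non-initial term of [f] that is not standard. *)
Lemma reduced_init_form_ideal_wdot f m : H f -> m \in msupp f ->
  wdot w m = wdot w (init_mon lt' f).
Proof.
move=> Hf mf; apply/eqP; apply: contrapT => /negP mc.
have Kf : init_form_ideal w I f by case: gbH => _ + _ _; exact.
pose p := wcomp w (wdot w m) f.
have Kp : init_form_ideal w I p by exact: wcomp_init_form_ideal.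
have p0 : p != 0.
  apply/eqP => /(congr1 (mcoeff m)); rewrite mcoeff_wcomp eqxx mcoeff0 => /eqP.
  by rewrite mcoeff_eq0 mf.
have up := init_mon_supp ltO' p0.
rewrite mcoeff_msupp mcoeff_wcomp in up.
case: ifP up => [/eqP uw|]; last by rewrite eqxx.
rewrite -mcoeff_msupp => uf.
apply: (reduced_tail ltO' rH Hf uf); last by apply: initial_mon_init.
by apply: contraNN mc => /eqP <-; rewrite uw.
Qed.

(** The normal form over [lt] is computed over [modified lt w], for which the same
    monomials are standard; so its weights are at most the weight of [f]. A term
    of equal weight is impossible, because [f] itself is the top part of an
    element of [I]. *)
Lemma normal_form_lift f : H f ->
  [/\ is_normal_form a lt I G f (normal_form a lt I G f)
    & forall m, m \in msupp (normal_form a lt I G f) ->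
        wdot w m < wdot w (init_mon lt' f)].
Proof.
move=> Hf; set c := wdot w (init_mon lt' f).
have mO := modified_tmo w ltO.
have [f0 [s Os hf]] : f != 0 /\ exists2 s, Omega s & homog a s f.
  by case: gbH => _ _ + _; exact.
have [S HS] := positively_graded_finite pg s.
have [r [Ir hr rn rle]] := reduces_to_exists iI hI HS mO hf.
have nf : is_normal_form a lt I G f r.
  split=> // [s' hf'|g m Gg mr].
    have m0f := init_mon_supp ltO f0.
    by rewrite -(hf' _ m0f) (hf _ m0f).
  apply/negP => gm; apply: (rn _ mr).
  apply/(closure_cell_initial_mon iI hI ltO ltw1 rG w1w pg).
    by rewrite (hr _ mr).
  exists g; split=> //; last exact: groebner_basis_neq0 gbG Gg.
  by case: gbG => _ + _ _; exact.
have -> : normal_form a lt I G f = r.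
  rewrite /normal_form; case: xgetP => [r' _ nf'|/(_ r)//].
  exact: is_normal_form_unique gbG Os hf nf' nf.
split=> // m mr.
have fle u : u \in msupp f -> wdot w u <= c.
  by move=> uf; rewrite /c (reduced_init_form_ideal_wdot Hf uf).
have rlec u : u \in msupp r -> wdot w u <= c.
  move=> /rle[v /fle vc [->//|/orP[uv|/andP[/eqP->//]]]].
  exact: le_trans (ltW uv) vc.
rewrite lt_neqAle rlec // andbT; apply/eqP => mc.
have Kf : init_form_ideal w I f by case: gbH => _ + _ _; exact.
have /init_form_idealE/(_ c)[//|f' [If' fc fE]] := Kf.
(* in weight c, the polynomials f' and f agree, so e and r agree *)
pose e := f' - (f - r).
have Ie : I e by exact: idealB.
have ec u : u \in msupp e -> wdot w u <= c.
  move=> /msuppB_le; rewrite mem_cat => /orP[/fc//|/msuppB_le].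
  by rewrite mem_cat => /orP[/fle|/rlec].
have eE u : wdot w u = c -> (u \in msupp e) = (u \in msupp r).
  by move=> uc; rewrite !mcoeff_msupp !mcoeffB fE // subKr.
have me : m \in msupp e by rewrite eE.
have e0 : e != 0 by rewrite -msupp_eq0; case: (msupp e) me.
have [ue umax] := init_monP mO e0.
apply: (rn (init_mon (modified lt w) e)); last exact: initial_mon_init.
rewrite -eE //; apply/eqP; rewrite eq_le ec //= -mc.
have [->//|mu] := eqVneq m (init_mon (modified lt w) e).
by have /orP[/ltW|/andP[/eqP->]] := umax m me mu.
Qed.

Lemma lift_init_mon f : H f ->
  [/\ I (f - normal_form a lt I G f), f - normal_form a lt I G f != 0
    & init_mon (modified lt' w) (f - normal_form a lt I G f) = init_mon lt' f].
Proof.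
move=> Hf; have [[Ir hr _]] := normal_form_lift Hf.
set r := normal_form _ _ _ _ _ in Ir hr * => rlt.
have f0 := groebner_basis_neq0 gbH Hf.
have [m0f m0max] := init_monP ltO' f0.
have m0d : init_mon lt' f \in msupp (f - r).
  rewrite mcoeff_msupp mcoeffB; have [/rlt|] := boolP (init_mon lt' f \in msupp r).
    by rewrite ltxx.
  by rewrite -mcoeff_eq0 => /eqP->; rewrite subr0 -mcoeff_msupp.
split=> //; first by rewrite -msupp_eq0; case: (msupp _) m0d.
apply: init_mon_unique => // [|u]; first exact: modified_tmo.
move=> /msuppB_le; rewrite mem_cat /modified => /orP[uf|/rlt->//] um.
by rewrite (reduced_init_form_ideal_wdot Hf uf) eqxx m0max ?orbT.
Qed.

(** The lifts have the same initial monomials as the elements of [H], which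
    generate irredundantly because [H] is reduced. *)
Lemma lift_minimal_groebner_basis :
  minimal_groebner_basis a Omega (modified lt' w) I
    [set f - normal_form a lt I G f | f in H].
Proof.
have mO := modified_tmo w ltO'.
split.
  apply: groebner_basisI => //.
  - by apply: finite_image; case: gbH.
  - by move=> _ [f Hf <-]; case: (lift_init_mon Hf).
  - move=> _ [f Hf <-]; split; first by case: (lift_init_mon Hf).
    have [_ _ Hh _] := gbH; have [_ [s Os hf]] := Hh f Hf.
    exists s => // m /msuppB_le; rewrite mem_cat => /orP[/hf//|].
    by have [[_ /(_ s hf) + _] _] := normal_form_lift Hf; exact.
  - move=> m Om /(initial_mon_init_form_ideal w iI ltO').
    move=> /(groebner_basis_div ltO' gbH Om)[f [Hf f0 fm]].
    have [_ d0 di] := lift_init_mon Hf.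
    by exists (f - normal_form a lt I G f); split=> //; [exists f|rewrite di].
move=> _ [f Hf <-] gb'; have [If d0 di] := lift_init_mon Hf.
have im := initial_mon_init (modified lt' w) If d0; rewrite di in im.
have Om := groebner_basis_homog gbH Hf (init_mon_supp ltO' (groebner_basis_neq0 gbH Hf)).
have [_ [[[f' Hf' <-] ne] _]] := groebner_basis_div mO gb' Om im.
have [_ _ ->] := lift_init_mon Hf' => dv.
by apply: ne; rewrite (reduced_init_inj ltO' rH Hf Hf' dv).
Qed.

End Lifting.

Theorem proposition5p1 (k : fieldType) (n : nat) (A : zmodType)
    (a : 'I_n -> A) (R : realType) (I : set {mpoly k[n]}) (Omega : set A)
    (lt1 lt2 : rel (multinom n)) (w1 w2 w : 'rV[R]_n) (G : set {mpoly k[n]}) :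
  positively_graded k a ->
  is_ideal I -> homogeneous a I ->
  truncating a Omega ->
  maximal_cell a Omega I w1 -> maximal_cell a Omega I w2 ->
  total_mult_order lt1 -> represented_by lt1 w1 ->
  total_mult_order lt2 -> represented_by lt2 w2 ->
  reduced_groebner_basis a Omega lt1 I G ->
  (closure (cell a Omega I w1) `&` closure (cell a Omega I w2)) w ->
  [/\ reduced_groebner_basis a Omega lt1 (init_form_ideal w I)
        [set init_form w g | g in G],
      (forall H, reduced_groebner_basis a Omega lt2 (init_form_ideal w I) H ->
         minimal_groebner_basis a Omega (modified lt2 w) I
           [set f - normal_form a lt1 I G f | f in H])
    & exists K,
        unique (reduced_groebner_basis a Omega (modified lt2 w) I) K /\
        unique (reduced_groebner_basis a Omega lt2 I) K].
Proof.
move=> pg iI hI _ _ _ ltO1 rep1 ltO2 rep2 rG [w1w w2w]; split.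
- exact: reduced_init_form rep1 _ w1w pg.
- by move=> H rH; exact: lift_minimal_groebner_basis rep1 rG w1w rH.
have [K rK] := reduced_groebner_basis_exists Omega ltO2 iI hI pg; exists K.
have rK' := reduced_modified iI hI ltO2 rep2 rK w2w pg.
by split; split=> // K'; apply: reduced_groebner_basis_uniq => //; exact: modified_tmo.
Qed.
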